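(* Let $A=(a_{ij})\in\mathbb{B}(n,n)$ be a matrix and let $\mathbf{X}=[\underline{x},\overline{x}]$ be an interval vector with $\underline{x},\overline{x}\in\mathbb{B}(n)$. Assume that $\underline{x}<c^*(A)$ and $\max_{i\in N}\underline{x}_i<\min_{i\in N}\overline{x}_i$. Then $A$ has $\mathbf{X}$-simple image eigenspace if and only if $A$ is an $\mathbf{X}$-conforming matrix.
   Context: $(\mathbb{B},\le)$ is a bounded linearly ordered set with least element $O$ and greatest element $I$; $a\oplus b=\max(a,b)$, $a\otimes b=\min(a,b)$, extended to matrices and vectors as in ordinary linear algebra, so $(A\otimes x)_i=\max_j\min(a_{ij},x_j)$. $N=\{1,\dots,n\}$; $\mathbb{B}(n,n)$ is the set of $n\times n$ matrices and $\mathbb{B}(n)$ the set of column $n$-vectors over $\mathbb{B}$. For vectors, $x\le y$ (resp. $x<y$) means $x_i\le y_i$ (resp. $x_i<y_i$) for every $i\in N$. $\mathbf{X}=[\underline{x},\overline{x}]=\{x\in\mathbb{B}(n):\underline{x}\le x\le\overline{x}\}$. Eigenvectors are fixed points: $V(A)=\{x\in\mathbb{B}(n):A\otimes x=x\}$. The greatest eigenvector is $x^{\oplus}(A)=\bigoplus_{x\in V(A)}x$ (componentwise maximum; it exists and lies in $V(A)$). An eigenvector $x\in V(A)\cap\mathbf{X}$ is an $\mathbf{X}$-simple image eigenvector if $x$ is the unique solution $y$ of $A\otimes y=x$ in $\mathbf{X}$. $A$ has $\mathbf{X}$-simple image eigenspace if every $x\in V(A)\cap\mathbf{X}$ is an $\mathbf{X}$-simple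 image eigenvector. $c(A)=\min_{i\in N}\max_{j\in N}a_{ij}$, $c^*(A)=(c(A),\dots,c(A))^T$, and $\gamma(A,\overline{x})=\min(c(A),\min_{i\in N}\overline{x}_i)$. For $h\in\mathbb{B}$ the threshold digraph $G(A,h)$ has node set $N$ and arc set $\{(i,j):a_{ij}\ge h\}$. $A$ is a level $\alpha$-permutation matrix if $G(A,\alpha)$ is a set of disjoint elementary cycles covering all the nodes (loops allowed); i.e. all entries of $A$ greater than or equal to $\alpha$ lie on disjoint elementary cycles covering all nodes. $\mathbf{X}$-conforming matrices. Let $\mathbf{X}=[\underline{x},\overline{x}]$ satisfy $\underline{x}<c^*(A)$ and $\max_i\underline{x}_i<\min_i\overline{x}_i$, and let $A$ be a level $\gamma(A,\overline{x})$-permutation matrix. Let $c_1,\dots,c_k$ be the elementary cycles of $G(A,\gamma(A,\overline{x}))$, and for each node $i$ let $\sigma(i)$ be its successor on its cycle (so $a_{i\sigma(i)}\ge\gamma(A,\overline{x})$). Define vectors $e_{\underline{x}}=(e_1,\dots,e_n)^T$ and $f_{\overline{x}}=(f_1,\dots,f_n)^T$ by $$e_i=\max_{v\in c_u}\underline{x}_v,\qquad f_i=\min_{v\in c_u}\bigl(\overline{x}_v\otimes x^{\oplus}_v(A)\bigr)\qquad\text{for } i\in c_u,\ u\in\{1,\dots,k\}.$$ $A$ is called $\mathbf{X}$-conforming (this includes being a level $\gamma(A,\overline{x})$-permutation matrix) if for every $i\in N$, with $c_u$ the cycle containing $i$: (1) if $\underline{x}_{\sigma(i)}<e_{\sigma(i)}$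 then $a_{ik}<e_i$ for all $k\in N$, $k\ne\sigma(i)$; (2) if $\underline{x}_{\sigma(i)}=e_{\sigma(i)}$ then $a_{ik}\le e_i$ for all $k\in N$, $k\ne\sigma(i)$; (3) if $a_{i\sigma(i)}=\min_{(k,l)\in c_u}a_{kl}=x^{\oplus}_{\sigma(i)}(A)=f_{\sigma(i)}$ then $\overline{x}_{\sigma(i)}\le x^{\oplus}_{\sigma(i)}(A)$. Here $(k,l)\in c_u$ means that the arc $(k,l)$ lies on the cycle $c_u$. *)

(* Defs.v *)
From mathcomp Require Import all_boot all_order all_algebra.
From mathcomp Require Import boolp classical_sets.

Set Implicit Arguments.
Unset Strict Implicit.
Unset Printing Implicit Defensive.

Import Order.TTheory.
Local Open Scope order_scope.
Local Open Scope classical_set_scope.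

(* The bounded chain (B, <=, O, I) is a tbOrderType with O = \bot, I = \top.  *)

Section MaxMin.
Context {d : Order.disp_t} {B : tbOrderType d}.

Definition mulmaxmin (m n p : nat) (A : 'M[B]_(m, n)) (C : 'M[B]_(n, p)) :
    'M[B]_(m, p) :=
  \matrix_(i, k) \big[Order.max / \bot]_j Order.min (A i j) (C j k).

Definition vle (n : nat) (x y : 'cV[B]_n) : Prop :=
  forall i, x i ord0 <= y i ord0.

Definition vlt (n : nat) (x y : 'cV[B]_n) : Prop :=
  forall i, x i ord0 < y i ord0.

Definition interval_vector (n : nat) (xl xu : 'cV[B]_n) : set 'cV[B]_n :=
  [set x | vle xl x /\ vle x xu].

Definition max_entry (n : nat) (x : 'cV[B]_n) : B :=
  \big[Order.max / \bot]_i x i ord0.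

Definition min_entry (n : nat) (x : 'cV[B]_n) : B :=
  \big[Order.min / \top]_i x i ord0.

Definition eigenspace (n : nat) (A : 'M[B]_n) : set 'cV[B]_n :=
  [set x | mulmaxmin A x = x].

(* The componentwise join of the (possibly infinite) eigenspace.  The default *)
(* value \bot of [supremum] is irrelevant: the set is inhabited (it contains  *)
(* \bot, as the vector of \bot's is an eigenvector) and it has a maximum.     *)
Definition greatest_eigenvector (n : nat) (A : 'M[B]_n) : 'cV[B]_n :=
  \col_i supremum \bot [set x i ord0 | x in eigenspace A].

Definition simple_image_eigenvector (n : nat) (A : 'M[B]_n)
    (X : set 'cV[B]_n) (x : 'cV[B]_n) : Prop :=
  (eigenspace A `&` X) x /\ [set y | X y /\ mulmaxmin A y = x] = [set x].

Definition simple_image_eigenspace (n : nat) (A : 'M[B]_n)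
    (X : set 'cV[B]_n) : Prop :=
  forall x, (eigenspace A `&` X) x -> simple_image_eigenvector A X x.

Definition cval (n : nat) (A : 'M[B]_n) : B :=
  \big[Order.min / \top]_i \big[Order.max / \bot]_j A i j.

Definition cstar (n : nat) (A : 'M[B]_n) : 'cV[B]_n := const_mx (cval A).

Definition gammaval (n : nat) (A : 'M[B]_n) (xu : 'cV[B]_n) : B :=
  Order.min (cval A) (min_entry xu).

Definition threshold_digraph (n : nat) (A : 'M[B]_n) (h : B) : rel 'I_n :=
  fun i j => h <= A i j.

(* A cycle is the list of its nodes in order, closed up from the last node to *)
(* the first; a loop is a singleton list.                                     *)
Definition arc_on (n : nat) (c : seq 'I_n) : rel 'I_n :=
  fun k l => (k \in c) && (l == next c k).

Definition elementary_cycle (n : nat) (e : rel 'I_n) (c : seq 'I_n) : Prop :=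
  c != [::] /\ ucycle e c.

(* The digraph e consists exactly of the pairwise disjoint elementary cycles  *)
(* listed in cs, which cover all the nodes.                                   *)
Definition cycle_decomposition (n : nat) (e : rel 'I_n)
    (cs : seq (seq 'I_n)) : Prop :=
  [/\ forall c, c \in cs -> elementary_cycle e c,
      uniq (flatten cs),
      forall i, i \in flatten cs
    & forall i j, e i j -> exists2 c, c \in cs & arc_on c i j].

Definition level_permutation (n : nat) (A : 'M[B]_n) (a : B) : Prop :=
  exists cs, cycle_decomposition (threshold_digraph A a) cs.

Definition cycle_of (n : nat) (cs : seq (seq 'I_n)) (i : 'I_n) : seq 'I_n :=
  head [::] [seq c <- cs | i \in c].

Definition succ_of (n : nat) (cs : seq (seq 'I_n)) (i : 'I_n) : 'I_n :=
  next (cycle_of cs i) i.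

Definition evec (n : nat) (cs : seq (seq 'I_n)) (xl : 'cV[B]_n) : 'cV[B]_n :=
  \col_i \big[Order.max / \bot]_(v <- cycle_of cs i) xl v ord0.

Definition fvec (n : nat) (A : 'M[B]_n) (cs : seq (seq 'I_n))
    (xu : 'cV[B]_n) : 'cV[B]_n :=
  \col_i \big[Order.min / \top]_(v <- cycle_of cs i)
    Order.min (xu v ord0) (greatest_eigenvector A v ord0).

Definition min_arc (n : nat) (A : 'M[B]_n) (c : seq 'I_n) : B :=
  \big[Order.min / \top]_(a : 'I_n * 'I_n | arc_on c a.1 a.2) A a.1 a.2.

Definition conforming_at (n : nat) (A : 'M[B]_n) (xl xu : 'cV[B]_n)
    (cs : seq (seq 'I_n)) (i : 'I_n) : Prop :=
  let s := succ_of cs i in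
  let e := evec cs xl in
  let f := fvec A cs xu in
  let g := greatest_eigenvector A in
  [/\ xl s ord0 < e s ord0 -> forall k, k != s -> A i k < e i ord0,
      xl s ord0 = e s ord0 -> forall k, k != s -> A i k <= e i ord0
    & [/\ A i s = min_arc A (cycle_of cs i),
          min_arc A (cycle_of cs i) = g s ord0
        & g s ord0 = f s ord0] ->
      xu s ord0 <= g s ord0].

(* The cycles of the digraph are determined up to their order in cs and the   *)
(* choice of a starting node on each of them, on which nothing else depends.  *)
Definition conforming (n : nat) (A : 'M[B]_n) (xl xu : 'cV[B]_n) : Prop :=
  level_permutation A (gammaval A xu) /\
  forall cs, cycle_decomposition (threshold_digraph A (gammaval A xu)) cs ->
    forall i, conforming_at A xl xu cs i.

End MaxMin.

(* Main.v *)
Require Import Defs.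
From mathcomp Require Import all_boot all_order ssralg matrix.
From mathcomp Require Import boolp classical_sets.

Set Implicit Arguments.
Unset Strict Implicit.
Unset Printing Implicit Defensive.

Import Order.TTheory.
Local Open Scope ring_scope.
Local Open Scope order_scope.
Local Open Scope classical_set_scope.

(** Write h for the level gamma(A, xu).  The hypotheses on xl and xu say exactly
    that every entry of xl lies strictly below h, while h is at most every row
    maximum of A and every entry of xu.  Hence the constant vector h is an
    eigenvector in the interval X (level_eigenvector), and it forces the
    permutation shape: if X-simplicity holds, lowering a single entry j of that
    vector must change its image, so some row has its only arc of level h at
    column j.  Matching columns with such rows is injective, hence bijective,
    and the arcs of level h are the graph of a permutation whose orbits are the
    cycles (simple_level_permutation, cycle_decomposition_exists).

    Let e be the cyclewise maximum of xl.  The heart of the argument is that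
    conditions (1) and (2) give domination: every arc off the cycles is at most
    e at its source.  Under domination an off-cycle term never exceeds
    the term of the cycle arc, so an eigenvector x above xl (hence above e)
    obeys x_i = min (a_(i, s i), x_(s i)) with s the successor map.  Such an x
    is therefore constant on each cycle, at most the smallest arc of that cycle,
    and conversely all cyclewise constant vectors between e and these smallest
    arcs are eigenvectors.  In particular the greatest eigenvector is the vector
    of smallest arcs (greatest_eigenvector_min_arc), which is what makes
    condition (3) readable.

    Necessity.  An off-cycle arc of height t at i that violates (1) or (2) gives
    the eigenvector max (e, t), in which row i is also supported by that arc, so
    entry s i can be lowered to its bound.  For this vector to be an eigenvector
    no off-cycle arc may exceed it at its source; a highest violation of
    domination has this property, and once domination is known so does every
    violation of (1) (simple_off_cycle_arc, simple_dominated).  If (3) fails, the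
    eigenvector equal to the smallest arc on the offending cycle and to h elsewhere allows
    entry s i to be raised to its upper bound, as the cycle arc caps row i.

    Sufficiency.  Let y in X have image x, an eigenvector in X.  Strictness in
    (1) ensures that x_i is reached by the term of the cycle arc of row i, so
    y_(s i) is at least x_i.  If it were larger, the arc would equal x_i, hence
    be the smallest arc of its cycle; as x lies below xu, all the equalities in
    the premise of (3) then hold, and its conclusion bounds y_(s i) by x_i after all
    (conforming_preimage_entry). *)

(** * Auxiliary facts on sequences and suprema *)

Lemma uniq_flatten_eq (T : eqType) (cs : seq (seq T)) c1 c2 x :
  uniq (flatten cs) -> c1 \in cs -> c2 \in cs -> x \in c1 -> x \in c2 ->
  c1 = c2.
Proof.
elim: cs => //= c cs IH; rewrite cat_uniq => /and3P[_ /hasPn dis ucs].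
rewrite !inE => /orP[/eqP->|c1s] /orP[/eqP->|c2s] xc1 xc2 //; last exact: IH.
- have /dis : x \in flatten cs by apply/flattenP; exists c2.
  by rewrite /= xc1.
- have /dis : x \in flatten cs by apply/flattenP; exists c1.
  by rewrite /= xc2.
Qed.

Lemma supremum_maximum (d : Order.disp_t) (T : orderType d) (x0 m : T)
    (S : set T) :
  S m -> ubound S m -> supremum x0 S = m.
Proof.
move=> Sm ubm; have supm : supremums S m by split=> // y; apply.
rewrite /supremum ifF; last first.
  by apply/negbTE/set0P; exists m.
case: xgetP => [y _ supy|/(_ m) []//].
exact: (is_subset1_supremums supy supm).
Qed.

(** * Cycles of a threshold digraph *)

Section Decomposition.
Context {d : Order.disp_t} {B : tbOrderType d} {n : nat}.
Variables (A : 'M[B]_n) (h : B).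

Section Existence.
Variable sigma : 'I_n -> 'I_n.
Hypothesis sigma_inj : injective sigma.

(** Orbits of different canonical roots are disjoint: a common point would make
    the two roots connected, hence equal. *)
Lemma uniq_flatten_orbits (rs : seq 'I_n) :
  uniq rs -> {in rs, forall r, froots sigma r} ->
  uniq (flatten [seq orbit sigma r | r <- rs]).
Proof.
elim: rs => //= r rs IH /andP[rNrs urs] rootP.
rewrite cat_uniq orbit_uniq IH //=; last first.
  by move=> s srs; apply: rootP; rewrite inE srs orbT.
rewrite andbT; apply/hasPn => i /flatten_mapP[s srs]; rewrite -fconnect_orbit.
move=> si; apply/negP; rewrite /= -fconnect_orbit => ri.
have sym := fconnect_sym sigma_inj.
have rs_conn : fconnect sigma r s by rewrite (connect_trans ri) // sym.
move: rs_conn; rewrite -(root_connect sym).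
rewrite (eqP (rootP r (mem_head _ _))) (eqP (rootP s _)) ?inE ?srs ?orbT //.
by move=> /eqP rs_eq; rewrite rs_eq srs in rNrs.
Qed.

Lemma cycle_decomposition_exists :
  (forall i j, (h <= A i j) = (j == sigma i)) -> level_permutation A h.
Proof.
move=> thr; have sym := fconnect_sym sigma_inj.
pose rs := enum (froots sigma).
have rsP r : (r \in rs) = froots sigma r by rewrite mem_enum.
have rootrs i : froot sigma i \in rs by rewrite rsP roots_root.
have in_orb i : i \in orbit sigma (froot sigma i).
  by rewrite -fconnect_orbit sym connect_root.
exists [seq orbit sigma r | r <- rs]; split.
- move=> _ /mapP[r _ ->]; split.
    by case: (orbit sigma r) (in_orbit sigma r).
  apply/andP; split; last exact: orbit_uniq.
  apply: sub_cycle (cycle_orbit sigma_inj r) => i j /eqP <-.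
  by rewrite /threshold_digraph thr.
- by apply: uniq_flatten_orbits => [|r]; rewrite ?enum_uniq ?rsP.
- by move=> i; apply/flatten_mapP; exists (froot sigma i).
- move=> i j; rewrite /threshold_digraph thr => /eqP ->.
  exists (orbit sigma (froot sigma i)); first exact: map_f.
  rewrite /arc_on in_orb /=; apply/eqP/eqP.
  exact: (next_cycle (cycle_orbit sigma_inj _)).
Qed.

End Existence.

Variable cs : seq (seq 'I_n).
Hypothesis csP : cycle_decomposition (threshold_digraph A h) cs.
Local Notation succ := (succ_of cs).

Lemma cycle_ofP i : cycle_of cs i \in cs /\ i \in cycle_of cs i.
Proof.
case: csP => _ _ cover _; have /flattenP[c ccs ic] := cover i.
have : cycle_of cs i \in [seq c <- cs | i \in c].
  rewrite /cycle_of; have : c \in [seq c <- cs | i \in c].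
    by rewrite mem_filter ic.
  by case: [seq _ <- _ | _] => //= a l _; rewrite mem_head.
by rewrite mem_filter => /andP[].
Qed.

Lemma mem_cycle_of i : i \in cycle_of cs i.
Proof. by case: (cycle_ofP i). Qed.

Lemma cycle_of_eq i c : c \in cs -> i \in c -> cycle_of cs i = c.
Proof.
case: csP (cycle_ofP i) => _ ucs _ _ [ci_cs ici] ccs ic.
exact: uniq_flatten_eq ucs ci_cs ccs ici ic.
Qed.

Lemma cycle_of_same i v : v \in cycle_of cs i -> cycle_of cs v = cycle_of cs i.
Proof. by apply: cycle_of_eq; case: (cycle_ofP i). Qed.

Lemma cycle_of_succ i : cycle_of cs (succ i) = cycle_of cs i.
Proof. by apply: cycle_of_same; rewrite mem_next mem_cycle_of. Qed.

Lemma mem_cycle_of_succ i j :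
  (succ j \in cycle_of cs i) = (j \in cycle_of cs i).
Proof.
apply/idP/idP => [sji|ji].
  by rewrite -(cycle_of_same sji) cycle_of_succ mem_cycle_of.
by rewrite -(cycle_of_same ji) -cycle_of_succ mem_cycle_of.
Qed.

Lemma succ_inj : injective succ.
Proof.
move=> i j sij; have eqc : cycle_of cs i = cycle_of cs j.
  by rewrite -cycle_of_succ sij cycle_of_succ.
have [ccs _] := cycle_ofP i; case: csP => cyc _ _ _.
have [_ /andP[_ uc]] := cyc _ ccs.
by apply: (can_inj (prev_next uc)); rewrite {2}eqc.
Qed.

Lemma threshold_succ i j : (h <= A i j) = (j == succ i).
Proof.
case: csP => cyc _ _ arcs; apply/idP/eqP => [/arcs[c ccs]|->].
  rewrite /arc_on /succ_of => /andP[ic /eqP ->].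
  by rewrite (cycle_of_eq ccs ic).
have [ccs ic] := cycle_ofP i; have [_ /andP[cc _]] := cyc _ ccs.
exact: next_cycle cc ic.
Qed.

Lemma arc_on_cycle_of i k l :
  arc_on (cycle_of cs i) k l = (k \in cycle_of cs i) && (l == succ k).
Proof.
rewrite /arc_on; case: (boolP (k \in _)) => //= ki.
by rewrite /succ_of (cycle_of_same ki).
Qed.

Lemma fcycle_cycle_of i : fcycle succ (cycle_of cs i).
Proof.
have [ccs _] := cycle_ofP i; case: csP => cyc _ _ _.
have [_ /andP[_ uc]] := cyc _ ccs.
apply: (sub_in_cycle (P := mem (cycle_of cs i))) (cycle_next uc); last first.
  exact/allP.
by move=> k l ki _ /eqP <-; rewrite /= /succ_of (cycle_of_same ki).
Qed.

(** The induction principle along a cycle: every node of the cycle of i is an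
    iterated successor of i. *)
Lemma cycle_of_closed_rel (r : 'I_n -> 'I_n -> Prop) :
  (forall i, r i i) -> (forall j i k, r i j -> r j k -> r i k) ->
  (forall i, r i (succ i)) -> forall i v, v \in cycle_of cs i -> r i v.
Proof.
move=> rr rt rs i v.
rewrite -(fconnect_cycle (fcycle_cycle_of i) (mem_cycle_of i)).
move=> /iter_findex <-; elim: findex => //= m IH.
exact: rt IH (rs _).
Qed.

(** A quantity that never increases from a node to its successor cannot decrease
    either, since the walk comes back to its starting node. *)
Lemma cycle_of_monotone d' (T : porderType d') (F : 'I_n -> T) :
  (forall i, F (succ i) <= F i) ->
  forall i v, v \in cycle_of cs i -> F v = F i.
Proof.
move=> Fs; have mono i v : v \in cycle_of cs i -> F v <= F i.
  move=> vi; apply: (cycle_of_closed_rel (r := fun i v => F v <= F i)) vi => //.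
  by move=> j k l kj /le_trans; apply.
move=> i v vi; apply/le_anti; rewrite mono //= mono //.
by rewrite (cycle_of_same vi) mem_cycle_of.
Qed.

Lemma min_arc_geP i b :
  reflect (forall v, v \in cycle_of cs i -> b <= A v (succ v))
          (b <= min_arc A (cycle_of cs i)).
Proof.
apply: (iffP idP) => [/bigmin_geP[_ le] v vi|le].
  by apply: (le (v, succ v)); rewrite arc_on_cycle_of /= vi eqxx.
apply/bigmin_geP; split; first exact: lex1.
by move=> [v w]; rewrite arc_on_cycle_of /= => /andP[vi /eqP ->]; apply: le.
Qed.

Lemma min_arc_le i : min_arc A (cycle_of cs i) <= A i (succ i).
Proof.
move/min_arc_geP: (lexx (min_arc A (cycle_of cs i))).
by apply; rewrite mem_cycle_of.
Qed.

Lemma level_le_min_arc i : h <= min_arc A (cycle_of cs i).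
Proof. by apply/min_arc_geP => v _; rewrite threshold_succ. Qed.

Section Evec.
Variable xl : 'cV[B]_n.
Local Notation e := (evec cs xl).

Lemma evec_leP i b :
  reflect (forall v, v \in cycle_of cs i -> xl v ord0 <= b) (e i ord0 <= b).
Proof.
rewrite mxE; apply: (iffP idP) => [le v vi|le].
  by apply: le_trans le; exact: (le_bigmax_seq _ _ _ _ vi isT).
by rewrite big_seq; apply: bigmax_le => //; exact: le0x.
Qed.

Lemma le_evec i : xl i ord0 <= e i ord0.
Proof. by move/evec_leP: (lexx (e i ord0)); apply; rewrite mem_cycle_of. Qed.

Lemma evec_succ i : e (succ i) ord0 = e i ord0.
Proof. by rewrite !mxE cycle_of_succ. Qed.

Lemma evec_lt i : (forall v, xl v ord0 < h) -> e i ord0 < h.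
Proof.
move=> xlh; rewrite mxE; apply: bigmax_lt => //.
by apply: le_lt_trans (xlh i); exact: le0x.
Qed.

End Evec.
End Decomposition.

(** * Images and eigenvectors in max-min algebra *)

Section Image.
Context {d : Order.disp_t} {B : tbOrderType d} {n : nat}.
Variable A : 'M[B]_n.
Implicit Types x y : 'cV[B]_n.

Lemma cV_eq x y : (forall i, x i ord0 = y i ord0) -> x = y.
Proof. by move=> xy; apply/matrixP => i j; rewrite ord1. Qed.

Lemma image_leP x i b :
  reflect (forall j, Order.min (A i j) (x j ord0) <= b)
          ((mulmaxmin A x) i ord0 <= b).
Proof.
rewrite mxE; apply: (iffP (bigmax_leP _ _ _ _)) => [[_ le] j|le].
  exact: le.
by split=> [|j _]; [exact: le0x|exact: le].
Qed.

Lemma term_le_image x i j :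
  Order.min (A i j) (x j ord0) <= (mulmaxmin A x) i ord0.
Proof. by move/image_leP: (lexx ((mulmaxmin A x) i ord0)); exact. Qed.

Lemma eigenvector_term_le x i j :
  eigenspace A x -> Order.min (A i j) (x j ord0) <= x i ord0.
Proof. by move=> {2}<-; exact: term_le_image. Qed.

Lemma image_eq x y :
  (forall i j, Order.min (A i j) (y j ord0) <= x i ord0) ->
  (forall i, exists k, x i ord0 <= Order.min (A i k) (y k ord0)) ->
  mulmaxmin A y = x.
Proof.
move=> le ge; apply: cV_eq => i; apply/le_anti/andP; split.
  exact/image_leP.
by have [k /le_trans] := ge i; apply; exact: term_le_image.
Qed.

Lemma eigenvector_max x y :
  eigenspace A x -> eigenspace A y ->
  eigenspace A (\col_i Order.max (x i ord0) (y i ord0)).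
Proof.
move=> Vx Vy; apply: cV_eq => i; rewrite -[in RHS]Vx -[in RHS]Vy !mxE.
by rewrite -bigmax_split; apply: eq_bigr => j _; rewrite mxE min_maxr.
Qed.

Definition set_entry x (j : 'I_n) (b : B) : 'cV[B]_n :=
  \col_i if i == j then b else x i ord0.

(** A row whose maximum is also reached outside column j does not see entry j
    decrease. *)
Lemma image_lowered x j b :
  eigenspace A x -> b <= x j ord0 ->
  (forall i, exists2 k, k != j & x i ord0 <= Order.min (A i k) (x k ord0)) ->
  mulmaxmin A (set_entry x j b) = x.
Proof.
move=> Vx bx wit; apply: image_eq => [i k|i].
  apply: le_trans (eigenvector_term_le i k Vx).
  by rewrite le_min2 // mxE; case: eqP => // ->.
by have [k /negbTE kj le] := wit i; exists k; rewrite mxE kj.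
Qed.

Lemma image_raised x j b :
  eigenspace A x -> x j ord0 <= b ->
  (forall i, Order.min (A i j) b <= x i ord0) ->
  mulmaxmin A (set_entry x j b) = x.
Proof.
move=> Vx xb le; apply: cV_eq => i; apply/le_anti/andP; split.
  apply/image_leP => k; rewrite mxE; case: eqP => [->|_]; first exact: le.
  exact: eigenvector_term_le.
rewrite -{1}Vx; apply/image_leP => k.
apply: le_trans (term_le_image _ i k).
by rewrite le_min2 // mxE; case: eqP => // ->.
Qed.

Lemma row_ge_cval t i : t <= cval A -> exists j, t <= A i j.
Proof.
move=> /bigmin_geP[_ /(_ i isT)].
have [|j _ ->] := @eq_bigmax _ _ _ \bot i xpredT (A i) isT.
  by move=> j _; exact: le0x.
by exists j.
Qed.

Lemma level_eigenvector t : t <= cval A -> eigenspace A (const_mx t).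
Proof.
move=> tc; apply: image_eq => [i j|i]; first by rewrite !mxE ge_min lexx orbT.
by have [j tA] := row_ge_cval i tc; exists j; rewrite !mxE le_min tA lexx.
Qed.

End Image.

(** * Eigenvectors above the lower bound *)

Section CyclewiseEigenvectors.
Context {d : Order.disp_t} {B : tbOrderType d} {n : nat}.
Variables (A : 'M[B]_n) (h : B) (cs : seq (seq 'I_n)).
Hypothesis csP : cycle_decomposition (threshold_digraph A h) cs.
Local Notation succ := (succ_of cs).

Lemma cyclewise_eigenvector (z : 'cV[B]_n) :
  (forall i, z (succ i) ord0 = z i ord0) ->
  (forall i, z i ord0 <= A i (succ i)) ->
  (forall i k, k != succ i -> Order.min (A i k) (z k ord0) <= z i ord0) ->
  eigenspace A z.
Proof.
move=> zs zA off; apply: image_eq => [i k|i].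
  by case: (eqVneq k (succ i)) => [->|/off//]; rewrite zs ge_min lexx orbT.
by exists (succ i); rewrite le_min zA zs lexx.
Qed.

Variable xl : 'cV[B]_n.
Hypothesis xl_lt : forall i, xl i ord0 < h.
Local Notation e := (evec cs xl).

Lemma evec_lt_arc i : e i ord0 < A i (succ i).
Proof.
by apply: lt_le_trans (evec_lt cs i xl_lt) _; rewrite (threshold_succ csP).
Qed.

(** Arcs of level h transport min (h, x) backwards along a cycle, so this
    truncation is constant on cycles; as xl stays below h, the truncation at i
    bounds xl on the whole cycle of i. *)
Lemma evec_le_eigenvector x :
  eigenspace A x -> vle xl x -> vle e x.
Proof.
move=> Vx xlx i; apply/evec_leP => v vi.
have : Order.min h (x v ord0) = Order.min h (x i ord0).
  apply: (cycle_of_monotone csP (F := fun v => Order.min h (x v ord0)) _ vi).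
  move=> j; rewrite le_min ge_min lexx /=.
  apply: le_trans (eigenvector_term_le j (succ j) Vx).
  by rewrite le_min2 // (threshold_succ csP).
move=> eq_hx; apply: le_trans (_ : Order.min h (x i ord0) <= _).
  by rewrite -eq_hx le_min (ltW (xl_lt v)) xlx.
by rewrite ge_min lexx orbT.
Qed.

Section Dominated.
Hypothesis dominated : forall i k, k != succ i -> A i k <= e i ord0.

(** The recursion that governs eigenvectors under domination: an off-cycle term
    is at most e_i, which is strictly below the cycle arc and at most the next
    entry of x. *)
Lemma eigenvector_succ x i :
  eigenspace A x -> vle e x ->
  x i ord0 = Order.min (A i (succ i)) (x (succ i) ord0).
Proof.
move=> Vx ex; apply/le_anti/andP; split; last exact: eigenvector_term_le.
rewrite -{1}Vx; apply/image_leP => k.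
case: (eqVneq k (succ i)) => [->//|/dominated Ae].
apply: le_trans (_ : e i ord0 <= _); first by rewrite ge_min Ae.
by rewrite le_min (ltW (evec_lt_arc i)) -(evec_succ csP) ex.
Qed.

Lemma eigenvector_cyclewise x i v :
  eigenspace A x -> vle e x -> v \in cycle_of cs i -> x v ord0 = x i ord0.
Proof.
move=> Vx ex.
(* The recursion makes x increase along the cycle, hence the dual order. *)
apply: (@cycle_of_monotone _ _ _ _ _ _ csP _ B^d (fun v => x v ord0)).
by move=> j; rewrite leEdual {1}(eigenvector_succ j Vx ex) ge_min lexx orbT.
Qed.

Lemma eigenvector_le_min_arc x i :
  eigenspace A x -> vle e x -> x i ord0 <= min_arc A (cycle_of cs i).
Proof.
move=> Vx ex; apply/(min_arc_geP csP) => v vi.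
rewrite -(eigenvector_cyclewise Vx ex vi).
by rewrite {1}(eigenvector_succ v Vx ex) ge_min lexx.
Qed.

Lemma dominated_eigenvector (z : 'cV[B]_n) :
  vle e z -> (forall i, z (succ i) ord0 = z i ord0) ->
  (forall i, z i ord0 <= A i (succ i)) -> eigenspace A z.
Proof.
move=> ez zs zA; apply: cyclewise_eigenvector => // i k /dominated Ae.
by rewrite ge_min (le_trans Ae).
Qed.

(** An arbitrary eigenvector need not lie above e, but its join with the vector
    m of smallest arcs is again an eigenvector and does, so the bound by
    smallest arcs applies to the join. *)
Lemma greatest_eigenvector_min_arc i :
  greatest_eigenvector A i ord0 = min_arc A (cycle_of cs i).
Proof.
pose m : 'cV[B]_n := \col_i min_arc A (cycle_of cs i).
have em : vle e m.
  move=> j; rewrite [m _ _]mxE.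
  exact: le_trans (ltW (evec_lt cs j xl_lt)) (level_le_min_arc csP j).
have Vm : eigenspace A m.
  apply: dominated_eigenvector => // j; rewrite !mxE ?(cycle_of_succ csP) //.
  exact: min_arc_le csP j.
rewrite mxE; apply: supremum_maximum; first by exists m; rewrite ?mxE.
move=> _ [x Vx <-].
have := @eigenvector_le_min_arc _ i (eigenvector_max Vx Vm).
rewrite mxE ge_max => le; suff /le/andP[] : vle e
    (\col_j Order.max (x j ord0) (m j ord0)) by [].
by move=> j; rewrite [leRHS]mxE le_max em orbT.
Qed.

End Dominated.
End CyclewiseEigenvectors.

(** * The interval and its level *)

Section SimpleImage.
Context {d : Order.disp_t} {B : tbOrderType d} {n : nat}.
Variables (A : 'M[B]_n) (xl xu : 'cV[B]_n).
Hypothesis hxl : vlt xl (cstar A).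
Hypothesis hxlu : max_entry xl < min_entry xu.
Local Notation h := (gammaval A xu).
Local Notation X := (interval_vector xl xu).

Lemma lower_lt_level i : xl i ord0 < h.
Proof.
rewrite lt_min; apply/andP; split; first by have := hxl i; rewrite mxE.
exact: le_lt_trans (le_bigmax _ (fun i => xl i ord0) i) hxlu.
Qed.

Lemma level_le_cval : h <= cval A.
Proof. by rewrite ge_min lexx. Qed.

Lemma level_le_upper i : h <= xu i ord0.
Proof.
by rewrite ge_min; apply/orP; right; exact: (bigmin_le _ i (xu^~ ord0)).
Qed.

Lemma set_entry_interval x j b :
  X x -> xl j ord0 <= b -> b <= xu j ord0 -> X (set_entry x j b).
Proof.
by move=> [lx xu_] lb bu; split=> i; rewrite mxE; case: eqP => // ->.
Qed.

(** * Simple image eigenspace implies conforming *)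

Section Necessity.
Hypothesis simple : simple_image_eigenspace A X.

Lemma simple_unique x y :
  eigenspace A x -> X x -> X y -> mulmaxmin A y = x -> y = x.
Proof.
move=> Vx Xx Xy Ay; have [_ eqX] := simple (conj Vx Xx).
by have : [set y | X y /\ mulmaxmin A y = x] y by []; rewrite eqX.
Qed.

Lemma simple_set_entry x j b :
  eigenspace A x -> X x -> xl j ord0 <= b -> b <= xu j ord0 ->
  mulmaxmin A (set_entry x j b) = x -> b = x j ord0.
Proof.
move=> Vx Xx lb bu Ay.
have := simple_unique Vx Xx (set_entry_interval Xx lb bu) Ay.
by move=> /matrixP/(_ j ord0); rewrite mxE eqxx.
Qed.

(** The vector obtained by lowering entry j to its bound still lies in the
    interval, so a row-by-row supply of other maximal terms would give a second
    preimage. *)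
Lemma simple_not_lowerable x j :
  eigenspace A x -> X x -> xl j ord0 < x j ord0 ->
  (forall i, exists2 k, k != j & x i ord0 <= Order.min (A i k) (x k ord0)) ->
  False.
Proof.
move=> Vx Xx ltx wit; have [lx ux] := Xx.
have xlu : xl j ord0 <= xu j ord0 := le_trans (lx j) (ux j).
have := simple_set_entry Vx Xx (lexx _) xlu (image_lowered Vx (ltW ltx) wit).
by move=> eqx; rewrite eqx ltxx in ltx.
Qed.

Lemma simple_not_raisable x j :
  eigenspace A x -> X x -> x j ord0 < xu j ord0 ->
  (forall i, Order.min (A i j) (xu j ord0) <= x i ord0) -> False.
Proof.
move=> Vx Xx ltx le; have [lx ux] := Xx.
have xlu : xl j ord0 <= xu j ord0 := le_trans (lx j) (ux j).
have := simple_set_entry Vx Xx xlu (lexx _) (image_raised Vx (ltW ltx) le).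
by move=> eqx; rewrite eqx ltxx in ltx.
Qed.

(** For each column j, the constant eigenvector h is not lowerable at j, which
    yields a row whose only arc of level h ends in j; sending j to that row is
    the inverse of the successor map. *)
Lemma simple_level_permutation : level_permutation A h.
Proof.
have Vh := level_eigenvector level_le_cval.
have Xh : X (const_mx h).
  by split=> i; rewrite mxE ?(ltW (lower_lt_level i)) // level_le_upper.
have sole j : {i | forall k, h <= A i k -> k = j}.
  apply: cid; apply: contrapT => none.
  apply: (simple_not_lowerable (j := j) Vh Xh).
    by rewrite mxE lower_lt_level.
  move=> i; apply/not_exists2P => off; apply: none; exists i => k hA.
  case: (off k) => [/negP|[]]; first by rewrite negbK => /eqP.
  by rewrite !mxE le_min hA lexx.
pose f j := sval (sole j); have fP j k : h <= A (f j) k -> k = j.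
  exact: svalP (sole j) k.
have row i := row_ge_cval i level_le_cval.
have f_inj : injective f.
  move=> j1 j2 eqf; have [k hk] := row (f j1).
  by rewrite -(fP _ _ hk) (fP j2 k) // -eqf.
have s_inj : injective (invF f_inj) by exact: can_inj (f_invF f_inj).
apply: (cycle_decomposition_exists s_inj) => i j.
rewrite -{1}(f_invF f_inj i); apply/idP/eqP => [/fP //|->].
by have [k hk] := row (f (invF f_inj i)); rewrite -{2}(fP _ _ hk).
Qed.

Variable cs : seq (seq 'I_n).
Hypothesis csP : cycle_decomposition (threshold_digraph A h) cs.
Local Notation succ := (succ_of cs).
Local Notation e := (evec cs xl).

(** In the eigenvector max (e, t) with t = a_ik, the arc (i, k) reaches the
    value t of row i by itself, and every other row keeps its own cycle arc,
    which does not end in succ i.  So entry succ i would be free to go down.  The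
    last hypothesis is what makes max (e, t) an eigenvector. *)
Lemma simple_off_cycle_arc i k :
  k != succ i -> xl (succ i) ord0 < A i k -> e i ord0 <= A i k ->
  (forall j l, l != succ j -> A j l <= Order.max (e j ord0) (A i k)) ->
  False.
Proof.
move=> ks xlt et off; set t := A i k in xlt et off.
have th : t < h by rewrite ltNge (threshold_succ csP).
pose x : 'cV[B]_n := \col_j Order.max (e j ord0) t.
have xs j : x (succ j) ord0 = x j ord0 by rewrite ![x _ _]mxE (evec_succ csP).
have xh j : x j ord0 < h by rewrite mxE gt_max th (evec_lt cs j lower_lt_level).
have xA j : x j ord0 <= A j (succ j).
  by apply: le_trans (ltW (xh j)) _; rewrite (threshold_succ csP).
have Vx : eigenspace A x.
  apply: cyclewise_eigenvector => // j l lj.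
  by rewrite [x j _]mxE ge_min off.
have Xx : X x.
  split=> j; last exact: le_trans (ltW (xh j)) (level_le_upper j).
  by rewrite mxE le_max (le_evec csP).
have xi : x i ord0 = t by rewrite mxE; apply/max_idPr.
apply: (simple_not_lowerable (j := succ i) Vx Xx).
  by rewrite xs xi.
move=> j; case: (eqVneq j i) => [->|ji].
  by exists k => //; rewrite xi le_min lexx mxE le_max lexx orbT.
exists (succ j); last by rewrite le_min xA xs lexx.
by apply: contra ji => /eqP sji; rewrite (succ_inj csP sji).
Qed.

Lemma simple_dominated i k : k != succ i -> A i k <= e i ord0.
Proof.
move=> ks; rewrite leNgt; apply/negP => lt_e.
pose bad (p : 'I_n * 'I_n) := (p.2 != succ p.1) && (e p.1 ord0 < A p.1 p.2).
have bad_ik : bad (i, k) by rewrite /bad /= ks.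
(* A violating arc of maximal height t: every violating arc is at most t, so
   all off-cycle arcs are at most max (e, t). *)
case: (@arg_maxP _ _ _ (i, k) bad (fun p => A p.1 p.2) bad_ik) => -[j l].
move=> /andP[/= lj lt_ej] maxA.
apply: (simple_off_cycle_arc lj); rewrite ?(ltW lt_ej) //.
  by apply: le_lt_trans lt_ej; rewrite -(evec_succ csP) (le_evec csP).
move=> j' l' lj'; rewrite le_max; case: leP => //= lt'.
by apply: (maxA (j', l')); rewrite /bad /= lj'.
Qed.

Lemma simple_conforming_at i : conforming_at A xl xu cs i.
Proof.
split=> [lt_e k ks|_ k|].
  (* Condition (1) strengthens domination to a strict inequality; equality would
     make (i, k) a supporting arc of height e_i, with xl below e_i at succ i. *)
- rewrite lt_neqAle simple_dominated // andbT; apply/eqP => eqA.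
  rewrite (evec_succ csP) in lt_e.
  apply: (simple_off_cycle_arc ks); rewrite ?eqA //.
  by move=> j l lj; rewrite le_max simple_dominated.
- exact: simple_dominated.
rewrite !(greatest_eigenvector_min_arc csP lower_lt_level simple_dominated).
rewrite !(cycle_of_succ csP) => -[eqA _ eqf].
rewrite leNgt; apply/negP => lt_u.
(* Row i is capped by the cycle arc, equal to the smallest arc of the cycle, so
   entry succ i may exceed that value unnoticed. *)
pose x : 'cV[B]_n :=
  \col_j if j \in cycle_of cs i then min_arc A (cycle_of cs i) else h.
have hm := level_le_min_arc csP i.
have hx j : h <= x j ord0 by rewrite mxE; case: ifP.
have ex : vle e x.
  by move=> j; apply: le_trans (hx j); exact: ltW (evec_lt cs j lower_lt_level).
have Vx : eigenspace A x.
  apply: (dominated_eigenvector simple_dominated) => // j.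
  - rewrite !mxE; congr (if _ then _ else _).
    by rewrite (mem_cycle_of_succ csP).
  rewrite mxE; case: ifP => [ji|_]; last by rewrite (threshold_succ csP).
  by rewrite -(cycle_of_same csP ji) (min_arc_le csP).
have Xx : X x.
  split=> j; first by apply: le_trans (ex j); exact: le_evec csP xl j.
  rewrite mxE; case: ifP => [ji|_]; last exact: level_le_upper.
  rewrite eqf mxE (cycle_of_succ csP).
  apply: le_trans (ge_bigmin_seq _ _ _ _ ji isT) _.
  by rewrite ge_min lexx.
have si : succ i \in cycle_of cs i.
  by rewrite (mem_cycle_of_succ csP) (mem_cycle_of csP).
apply: (simple_not_raisable (j := succ i) Vx Xx); first by rewrite mxE si.
move=> j; case: (eqVneq j i) => [->|ji].
  by rewrite mxE (mem_cycle_of csP) eqA ge_min lexx.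
have sij : succ i != succ j.
  by apply: contra ji => /eqP sij; rewrite (succ_inj csP sij).
by rewrite ge_min (le_trans (simple_dominated sij)) ?ex.
Qed.

End Necessity.

(** * Conforming implies simple image eigenspace *)

Section Sufficiency.
Variable cs : seq (seq 'I_n).
Hypothesis csP : cycle_decomposition (threshold_digraph A h) cs.
Hypothesis conf : forall i, conforming_at A xl xu cs i.
Local Notation succ := (succ_of cs).
Local Notation e := (evec cs xl).

Lemma conforming_dominated i k : k != succ i -> A i k <= e i ord0.
Proof.
case: (conf i) => c1 c2 _ ks.
have := le_evec csP xl (succ i); rewrite le_eqVlt => /predU1P[/c2|/c1 lt].
  exact.
exact: ltW (lt k ks).
Qed.

(** The preimage y is determined entry by entry: row i of the equation pins down
    the entry of y at the successor of i. *)
Lemma conforming_preimage_entry x y i :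
  eigenspace A x -> X x -> X y -> mulmaxmin A y = x ->
  y (succ i) ord0 = x i ord0.
Proof.
move=> Vx [lx ux] [ly uy] Ay.
have ex := evec_le_eigenvector csP lower_lt_level Vx lx.
have cyc := eigenvector_cyclewise csP lower_lt_level conforming_dominated Vx ex.
have xm := eigenvector_le_min_arc csP lower_lt_level conforming_dominated i
  Vx ex.
have eA := evec_lt_arc csP lower_lt_level i.
have Ayx : Order.min (A i (succ i)) (y (succ i) ord0) <= x i ord0.
  by rewrite -Ay term_le_image.
have [c1 _ c3] := conf i.
have mA := min_arc_le csP i.
(* If the cycle term fell short, all terms would: off-cycle arcs are strictly
   below e_i by (1) when xl is below e_i at succ i, and otherwise y >= xl
   already lifts the cycle term to e_i. *)
have reached : x i ord0 <= Order.min (A i (succ i)) (y (succ i) ord0).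
  rewrite leNgt; apply/negP => lt_x.
  have : (mulmaxmin A y) i ord0 < x i ord0.
    rewrite mxE; apply: bigmax_lt => [|k _].
      exact: le_lt_trans (le0x _) lt_x.
    case: (eqVneq k (succ i)) => [->//|ks]; rewrite gt_min; apply/orP; left.
    have := le_evec csP xl (succ i); rewrite (evec_succ csP) le_eqVlt.
    move=> /predU1P[eq_e|lt_e]; last first.
      by apply: lt_le_trans (ex i); apply: c1 => //; rewrite (evec_succ csP).
    apply: le_lt_trans (conforming_dominated ks) (le_lt_trans _ lt_x).
    by rewrite le_min (ltW eA) -eq_e ly.
  by rewrite Ay ltxx.
have [xA xy] : x i ord0 <= A i (succ i) /\ x i ord0 <= y (succ i) ord0.
  by move: reached; rewrite le_min => /andP[].
apply/le_anti; rewrite xy andbT.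
have [lt_xA|Ax] := ltP (x i ord0) (A i (succ i)).
  by move: Ayx; rewrite ge_min leNgt lt_xA.
(* From here on the arc itself equals x_i, the case that (3) controls. *)
have eqA : A i (succ i) = x i ord0 by apply/le_anti; rewrite Ax xA.
have eqm : min_arc A (cycle_of cs i) = x i ord0.
  by apply/le_anti; rewrite xm andbT (le_trans mA Ax).
have gm j : greatest_eigenvector A j ord0 = min_arc A (cycle_of cs j).
  exact: (greatest_eigenvector_min_arc csP lower_lt_level conforming_dominated).
apply: le_trans (uy _) _; rewrite -eqm -(cycle_of_succ csP) -gm.
apply: c3; split; rewrite ?gm ?(cycle_of_succ csP) ?eqm //.
apply/esym/le_anti/andP; rewrite mxE (cycle_of_succ csP); split.
  apply: le_trans (ge_bigmin_seq _ _ _ _ (mem_cycle_of csP i) isT) _.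
  by rewrite ge_min gm eqm lexx orbT.
rewrite big_seq; apply: le_bigmin => [|v vi]; first exact: lex1.
by rewrite le_min gm (cycle_of_same csP vi) eqm lexx andbT -(cyc _ _ vi) ux.
Qed.

Lemma conforming_preimage_unique x y :
  eigenspace A x -> X x -> X y -> mulmaxmin A y = x -> y = x.
Proof.
move=> Vx Xx Xy Ay; apply: cV_eq => j.
have [p _ sp] := injF_bij (succ_inj csP).
rewrite -(sp j) (conforming_preimage_entry _ Vx Xx Xy Ay).
by rewrite (conforming_preimage_entry _ Vx Xx Xx Vx).
Qed.

End Sufficiency.
End SimpleImage.

Theorem theorem3p8 (d : Order.disp_t) (B : tbOrderType d) (n : nat)
    (hn : (0 < n)%N) (A : 'M[B]_n) (xl xu : 'cV[B]_n)
    (hxl : vlt xl (cstar A)) (hxlu : max_entry xl < min_entry xu) :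
  simple_image_eigenspace A (interval_vector xl xu) <-> conforming A xl xu.
Proof.
split=> [simple|[[cs csP] conf] x [Vx Xx]].
  split; first exact: simple_level_permutation.
  by move=> cs csP i; exact: simple_conforming_at.
split; first by split.
apply/seteqP; split=> [y [Xy Ay]|y ->] //=.
exact: (conforming_preimage_unique hxl hxlu csP (conf cs csP) Vx Xx Xy Ay).
Qed.
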